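(* If $r \geq 5$ is an integer not equal to $6$, $p$ a polynomial of one variable, and $b,b'>0$ any constants, then there exists a diagram $D$ such that if $D \sim_r D'$ then \begin{align*} g(D') > b\log(c(D))+b' \text{ unless} \\ dist_r(D, D') > p(c(D)). \end{align*}
   Context: Links $L$ are smooth links of finitely many components in $\mathbb{R}^3$, and diagrams $D$ are their planar diagrams in the $xz$-plane, taken in Morse position with respect to the $z$-coordinate. The girth of a diagram, $g(D)$, is the maximum over all lines $z=\text{constant}$ of $|D \cap (z=\text{constant})|$. The complexity number $c(D)$ of a diagram is half its number of crossings plus half its number of local maxima and minima with respect to $z$; for a link, $c(L)=\min\{c(D) \mid D \text{ is a diagram of } L\}$. For an integer $r \geq 5$, $r\neq 6$, the equivalence relation $\sim_r$ on links is generated by passing from $L$ to $L \coprod U$, with $U$ an additional unknotted component, and then performing $\frac{\pm 1}{4r}$-Dehn surgery on $U$ to obtain $L'$; equivalently, one repeatedly takes an embedded 2-disk $\Delta$ transverse to $L$ and performs a $\pm 8\pi r$ twist across $\Delta$. On diagrams, $D \sim_r D'$ means $D$ represents $L$, $D'$ represents $L'$, and $L \sim_r L'$. After Reidemeister/Morse moves one may assume the disk $\Delta$ bounded by $U$ meets the diagram in a standard form, with $n$ parallel horizontal strands of the diagram passing through $\Delta$. The distance $dist_r(D,D')$ is the minimum total weight of a sequence of steps from $D$ to $D'$, where each Reidemeister/Morse move (Reidemeister 2 and 3, births, deaths, level crossings) has weight $1$, Reidemeister 1 has weight $\frac{3}{2}$, and each standard-form $\pm 4r$-twist along such a $\Delta$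 meeting $n$ strands has weight $2rn(n-1)$ (half the $4rn(n-1)$ crossings it introduces). *)

(* Defs.v *)
From HB Require Import structures.
From Stdlib Require Import Relations.
From mathcomp Require Import all_boot all_order all_algebra.
From mathcomp Require Import all_classical all_reals all_analysis.

Set Implicit Arguments.
Unset Strict Implicit.
Unset Printing Implicit Defensive.

Import Order.TTheory GRing.Theory Num.Theory.
Import numFieldNormedType.Exports.

Local Open Scope classical_set_scope.
Local Open Scope ring_scope.

(** * Diagrams in Morse position

    A planar diagram in Morse position has its critical points and crossings at
    pairwise distinct heights; up to planar isotopy preserving these levels it
    is the word of its events, read from bottom to top.  Positions count the
    strands to the left of the event (from 0):
    - [Cup i]: a local minimum with [i] strands to its left;
    - [Cap i]: a local maximum with [i] strands to its left;
    - [Cross b i]: a crossing of the strands [i] and [i.+1]; the strand going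
      from bottom left to top right is the overstrand iff [b = true]. *)

Inductive event := Cup of nat | Cap of nat | Cross of bool & nat.

Definition position (e : event) : nat :=
  match e with Cup i => i | Cap i => i | Cross _ i => i end.

(* Number of strands ending at the event from below, resp. leaving it upwards. *)
Definition ein (e : event) : nat := if e is Cup _ then 0 else 2.
Definition eout (e : event) : nat := if e is Cap _ then 0 else 2.

Definition is_crossing (e : event) : bool := if e is Cross _ _ then true else false.
Definition is_extremum (e : event) : bool := ~~ is_crossing e.

Definition shift_event (k : nat) (e : event) : event :=
  match e with
  | Cup i => Cup (k + i)%N
  | Cap i => Cap (k + i)%N
  | Cross b i => Cross b (k + i)%N
  end.

Fixpoint closed_from (n : nat) (D : seq event) : bool :=
  if D is e :: D' then
    (position e + ein e <= n)%N && closed_from (n - ein e + eout e)%N D'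
  else n == 0%N.

(* Links have at least one component: the empty diagram, for which
   [log (c D)] would be meaningless, is excluded. *)
Record diagram := Diagram {
  word :> seq event;
  word_nonempty : (0 < size word)%N;
  word_closed : closed_from 0 word
}.

(* Numbers of points of the diagram on horizontal lines: one entry for each
   interval of regular levels, and one for the level of each event, where the
   [ein e] strands ending at the event are replaced by a single point. *)
Fixpoint line_counts (n : nat) (D : seq event) : seq nat :=
  n :: (if D is e :: D' then
          (n - ein e)%N.+1 :: line_counts (n - ein e + eout e)%N D'
        else [::]).

Definition girth (D : diagram) : nat := \max_(k <- line_counts 0 D) k.

Definition complexity (R : realType) (D : diagram) : R :=
  (count is_crossing D)%:R / 2 + (count is_extremum D)%:R / 2.

(** * Weighted moves and the distance on diagrams *)

(* The local moves, each of which may also be performed backwards.  Words only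
   see Morse position, so level crossings comprise the exchange of the heights
   of two events next to each other, and a crossing passing an extremum that
   lies on one of its two strands. *)
Inductive RMmove (R : realType) : seq event -> seq event -> R -> Prop :=
| R1_right (b : bool) (i : nat) :
    RMmove [:: Cup i.+1; Cross b i; Cap i.+1] [::] (3%:R / 2)
| R1_left (b : bool) (i : nat) :
    RMmove [:: Cup i; Cross b i.+1; Cap i] [::] (3%:R / 2)
| R1_max (b : bool) (i : nat) :
    RMmove [:: Cross b i; Cap i] [:: Cap i] (3%:R / 2)
| R1_min (b : bool) (i : nat) :
    RMmove [:: Cup i; Cross b i] [:: Cup i] (3%:R / 2)
| R2 (b : bool) (i : nat) :
    RMmove [:: Cross b i; Cross (~~ b) i] [::] 1
| R3 (a b c : bool) (i : nat) :
    (* when [a = c <> b] no strand is the top one and there is no move *)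
    (a = b) \/ (b = c) ->
    RMmove [:: Cross a i; Cross b i.+1; Cross c i]
           [:: Cross c i.+1; Cross b i; Cross a i.+1] 1
| death_right (i : nat) :
    RMmove [:: Cup i; Cap i.+1] [::] 1
| death_left (i : nat) :
    RMmove [:: Cup i.+1; Cap i] [::] 1
| level_far (e f : event) :
    (* [f] lies to the right of [e] *)
    (position e <= position f)%N ->
    RMmove [:: e; shift_event (eout e) f] [:: shift_event (ein e) f; e] 1
| level_max (b : bool) (i : nat) :
    RMmove [:: Cross b i.+1; Cap i] [:: Cross (~~ b) i; Cap i.+1] 1
| level_min (b : bool) (i : nat) :
    RMmove [:: Cup i; Cross b i.+1] [:: Cup i.+1; Cross (~~ b) i] 1.

(* [k] full twists, of sign [b], on the [n] parallel strands
   [i], ..., [i + n - 1]; a full twist is the [n]-th power of the braid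
   [s_i s_(i+1) ... s_(i+n-2)], hence has [n * (n - 1)] crossings. *)
Definition full_twists (b : bool) (k i n : nat) : seq event :=
  flatten (nseq (k * n)%N [seq Cross b j | j <- iota i n.-1]).

Inductive diagram_step (R : realType) (r : nat) (D D' : diagram) : R -> Prop :=
| step_RM (u l m v : seq event) (w : R) :
    RMmove l m w \/ RMmove m l w ->
    word D = u ++ l ++ v -> word D' = u ++ m ++ v -> diagram_step r D D' w
| step_twist (u v : seq event) (b : bool) (i n : nat) :
    word D = u ++ v -> word D' = u ++ full_twists b (4 * r)%N i n ++ v ->
    diagram_step r D D' (2 * r * n * n.-1)%N%:R.

Inductive weighted_path (R : realType) (r : nat) :
  diagram -> diagram -> R -> Prop :=
| path_nil (D : diagram) : weighted_path r D D 0
| path_cons (D D1 D2 : diagram) (w W : R) :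
    diagram_step r D D1 w -> weighted_path r D1 D2 W ->
    weighted_path r D D2 (w + W).

(* All weights are nonnegative half-integers, so the infimum is a minimum as
   soon as a path exists; otherwise it is [+oo]. *)
Definition dist (R : realType) (r : nat) (D D' : diagram) : \bar R :=
  ereal_inf [set W%:E | W in [set W : R | weighted_path r D D' W]].

(** * Smooth links in R^3 *)

Definition cx (R : realType) (v : 'rV[R]_3) : R := v 0 0.
Definition cy (R : realType) (v : 'rV[R]_3) : R := v 0 1.
Definition cz (R : realType) (v : 'rV[R]_3) : R := v 0 2%:R.

Definition vec3 (R : realType) (x y z : R) : 'rV[R]_3 :=
  \row_(j < 3) [:: x; y; z]`_j.

Definition smooth1 (R : realType) (f : R -> R) : Prop :=
  forall (n : nat) (t : R), derivable (derive1n n f) t 1.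

Definition partial (R : realType) (n : nat) (i : 'I_n.+1)
    (f : 'rV[R]_n.+1 -> R) : 'rV[R]_n.+1 -> R :=
  fun v => 'D_(delta_mx 0 i) f v.

(* C^oo: all iterated partial derivatives exist and are continuous. *)
Definition smooth (R : realType) (n : nat) (f : 'rV[R]_n.+1 -> R) : Prop :=
  forall s : seq 'I_n.+1, let g := foldr (@partial R n) f s in
    continuous g /\ forall (i : 'I_n.+1) v, derivable g v (delta_mx 0 i).

Definition smooth_map (R : realType) (n m : nat)
    (F : 'rV[R]_n.+1 -> 'rV[R]_m) : Prop :=
  forall j : 'I_m, smooth (fun v => F v 0 j).

Section Curves.
Context (R : realType) (n : nat) (gam : 'I_n -> R -> 'rV[R]_3).

(* [n] disjoint smoothly embedded circles, each parametrized with period 1. *)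
Definition link_param : Prop :=
  [/\ (0 < n)%N,
      forall c (j : 'I_3), smooth1 (fun t => gam c t 0 j),
      forall c t, exists j : 'I_3, derive1 (fun u => gam c u 0 j) t != 0
    & forall c t c' t', gam c t = gam c' t' <->
        c = c' /\ exists k : int, t' = t + k%:~R].

Definition trace : set 'rV[R]_3 := [set v | exists c t, v = gam c t].

Definition dx (c : 'I_n) (t : R) : R := derive1 (fun u => cx (gam c u)) t.
Definition dz (c : 'I_n) (t : R) : R := derive1 (fun u => cz (gam c u)) t.
Definition ddz (c : 'I_n) (t : R) : R := derive1n 2 (fun u => cz (gam c u)) t.

(* The points of the link at height [z] lying over a critical point or a
   multiple point of the projection [(x, y, z) |-> (x, z)]. *)
Definition singular (z : R) : set 'rV[R]_3 :=
  [set v | cz v = z /\ exists c t, v = gam c t /\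
     (dz c t = 0 \/
      exists w, [/\ trace w, w <> v, cx w = cx v & cz w = cz v])].

(* Exactly [i] points of the projection at the height of [v] are to the left
   of [v]. *)
Definition left_strands (v : 'rV[R]_3) (i : nat) : Prop :=
  ([set x | (x < cx v)%R /\ exists w, [/\ trace w, cx w = x & cz w = cz v]]
     #= `I_i)%card.

(* At height [z] the projection has exactly one singularity: a nondegenerate
   extremum, or a transverse double point, of the type described by [e].
   The diagram is seen from [y = -oo], with [x] pointing to the right and [z]
   upwards, so the overstrand is the one with the smaller [y]. *)
Definition event_at (z : R) (e : event) : Prop :=
  match e with
  | Cup i => exists c t,
      [/\ singular z = [set gam c t], left_strands (gam c t) i,
          dz c t = 0, 0 < ddz c t & dx c t != 0]
  | Cap i => exists c t,
      [/\ singular z = [set gam c t], left_strands (gam c t) i,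
          dz c t = 0, ddz c t < 0 & dx c t != 0]
  | Cross b i => exists c t c' t',
      [/\ singular z = [set gam c t; gam c' t'],
          left_strands (gam c t) i,
          cx (gam c t) = cx (gam c' t') /\ cy (gam c t) < cy (gam c' t'),
          dz c t != 0 /\ dz c' t' != 0
        & if b then dx c' t' / dz c' t' < dx c t / dz c t
          else dx c t / dz c t < dx c' t' / dz c' t']
  end.

Definition has_diagram (D : seq event) : Prop :=
  exists h : nat -> R,
    [/\ forall k l, (k < l < size D)%N -> h k < h l,
        forall k, (k < size D)%N -> event_at (h k) (nth (Cup 0) D k)
      & forall z, singular z !=set0 -> exists2 k, (k < size D)%N & z = h k].

End Curves.

Definition is_link (R : realType) (L : set 'rV[R]_3) : Prop :=
  exists n (gam : 'I_n -> R -> 'rV[R]_3), link_param gam /\ L = trace gam.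

(* Smooth ambient isotopy [H] from the identity, with inverse [K]. *)
Definition isotopic (R : realType) (L L' : set 'rV[R]_3) : Prop :=
  exists H K : R -> 'rV[R]_3 -> 'rV[R]_3,
    [/\ smooth_map (fun w : 'rV[R]_(1 + 3) => H (lsubmx w 0 0) (rsubmx w)),
        smooth_map (fun w : 'rV[R]_(1 + 3) => K (lsubmx w 0 0) (rsubmx w)),
        forall t, cancel (H t) (K t) /\ cancel (K t) (H t),
        forall v, H 0 v = v
      & H 1 @` L = L'].

Definition represents (R : realType) (D : diagram) (L : set 'rV[R]_3) : Prop :=
  exists n (gam : 'I_n -> R -> 'rV[R]_3),
    [/\ link_param gam, has_diagram gam D & isotopic (trace gam) L].

(** * The equivalence relation [~_r] *)

(* Rotation by [a * s z] of the horizontal unit disk at height [z], and the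
   identity off the unit cylinder.  When [s] is a step from 0 (for [z <= 0])
   to 1 (for [1 <= z]) and [a] is a multiple of [2 * pi], this is a twist of
   total angle [a] supported in the solid cylinder over [0 <= z <= 1]. *)
Definition twist_map (R : realType) (a : R) (s : R -> R) (v : 'rV[R]_3) :
    'rV[R]_3 :=
  if cx v ^+ 2 + cy v ^+ 2 <= 1 then
    let th := a * s (cz v) in
    vec3 (cos th * cx v - sin th * cy v) (sin th * cx v + cos th * cy v) (cz v)
  else v.

(* [L'] is obtained from [L] by a [+- 8 pi r] twist across an embedded disk
   transverse to [L].  By a diffeomorphism [Phi] of R^3 a product neighbourhood
   of the disk becomes the solid cylinder, which [L] meets in vertical
   segments away from its wall.  Both signs being allowed, the orientation
   of [Phi] is irrelevant. *)
Definition twisted (R : realType) (r : nat) (L L' : set 'rV[R]_3) : Prop :=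
  exists (Phi Psi : 'rV[R]_3 -> 'rV[R]_3) (s : R -> R) (sgn : bool),
    [/\ [/\ smooth_map Phi, smooth_map Psi, cancel Phi Psi & cancel Psi Phi],
        [/\ smooth1 s, forall z, z <= 0 -> s z = 0 & forall z, 1 <= z -> s z = 1],
        forall x y z, x ^+ 2 + y ^+ 2 <= 1 -> 0 <= z <= 1 ->
          L (Phi (vec3 x y z)) ->
          x ^+ 2 + y ^+ 2 < 1 /\
          forall z', 0 <= z' <= 1 -> L (Phi (vec3 x y z'))
      & L' = [set Phi (twist_map ((-1) ^+ sgn * (8 * pi * r%:R)) s v)
                | v in Phi @^-1` L]].

(* Links are taken up to isotopy. *)
Definition link_sim (R : realType) (r : nat) :
    set 'rV[R]_3 -> set 'rV[R]_3 -> Prop :=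
  clos_refl_sym_trans _ (fun L L' : set 'rV[R]_3 =>
    [/\ is_link L, is_link L' & isotopic L L' \/ twisted r L L']).

Definition diagram_sim (R : realType) (r : nat) (D D' : diagram) : Prop :=
  exists L L' : set 'rV[R]_3,
    [/\ represents D L, represents D' L' & link_sim r L L'].

(* Main.v *)
(**
  The moves and the twists preserve the components of a link and, for two
  components A <> B, the parity of the number of crossings at which A passes
  over B (their linking number mod 2): in [4 r] full twists two strands pass
  over one another [4 r] times.  If D is the closed full twist on n strands,
  its n components are pairwise linked with odd linking numbers, so the same
  holds for every D' joined to D by moves.  The height ranges of two linked
  components must intersect, and by Helly's theorem on the line some horizontal
  line then meets all n components of D', so that its girth is at least n.
  As c(D) = n (n + 1) / 2, this exceeds b log c(D) + b' for n large.  A diagram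
  D' not joined to D by moves is at distance +oo.

  Components are handled through labellings of the strands: a diagram with n
  minima has at most n components since its labellings use at most n labels.
*)
Require Import Defs.
From mathcomp Require Import all_boot all_order all_algebra.
From mathcomp Require Import all_classical all_reals all_analysis.
From mathcomp Require Import zify lra.

Set Implicit Arguments.
Unset Strict Implicit.
Unset Printing Implicit Defensive.

(** * Labellings of the strands and their overcrossings *)

Section Labellings.
Context {T : eqType}.
Implicit Types (s t u v w : seq T) (o : seq (T * T)) (e f : event)
  (D l m : seq event).

(* [w] and [w'] are the labels of the strands below and above the event, [o]
   the labels of the overstrand and of the understrand if it is a crossing. *)
Definition label_event e w o w' : Prop :=
  match e with
  | Cup _ => exists x, [/\ w = [::], o = [::] & w' = [:: x; x]]
  | Cap _ => exists x, [/\ w = [:: x; x], o = [::] & w' = [::]]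
  | Cross b _ => exists x y,
      [/\ w = [:: x; y], o = [:: if b then (x, y) else (y, x)]
        & w' = [:: y; x]]
  end.

Definition label_step s e o t : Prop := exists u w w' v,
  [/\ size u = position e, s = u ++ w ++ v, t = u ++ w' ++ v
    & label_event e w o w'].

Fixpoint labelling s D o t : Prop :=
  if D is e :: D' then
    exists s1 o1 o2, [/\ label_step s e o1 s1, labelling s1 D' o2 t
      & o = o1 ++ o2]
  else t = s /\ o = [::].

(** Diagonal pairs are left out because Reidemeister 1 moves add or remove a self-crossing. *)
Definition same_parity o o' := forall p q, p != q ->
  odd (count_mem (p, q) o) = odd (count_mem (p, q) o').

Lemma same_parity_cat o1 o1' o2 o2' : same_parity o1 o1' ->
  same_parity o2 o2' ->
  same_parity (o1 ++ o2) (o1' ++ o2').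
Proof. by move=> h1 h2 p q pq; rewrite !count_cat !oddD h1 // h2. Qed.

Lemma same_parity_sym o o' : same_parity o o' -> same_parity o' o.
Proof. by move=> h p q /h. Qed.

Lemma labelling_cat s D1 D2 o t : labelling s (D1 ++ D2) o t <->
  exists s1 o1 o2, [/\ labelling s D1 o1 s1, labelling s1 D2 o2 t
    & o = o1 ++ o2].
Proof.
elim: D1 s o => [|e D1 IH] s o /=; split.
- by move=> h; exists s, [::], o.
- by case=> s1 [ o1] [ o2] [[-> ->] h ->].
- case=> s1 [ o1] [ o2] [h1 /IH[s2 [ o3] [ o4] [h3 h4 ->]] ->].
  by exists s2, (o1 ++ o3), o4; rewrite catA; split=> //; exists s1, o1, o3.
- case=> s2 [ o3] [ o4] [[s1] [ o1] [ o2] [h1 h2 ->] h4 ->].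
  exists s1, o1, (o2 ++ o4); rewrite catA; split=> //.
  by apply/IH; exists s2, o2, o4.
Qed.

Lemma label_event_size e w o w' : label_event e w o w' ->
  size w = ein e /\ size w' = eout e.
Proof.
case: e => [i|i|b i] /=; first by case=> x [-> _ ->].
  by case=> x [-> _ ->].
by case=> x [y] [-> _ ->].
Qed.

Lemma label_step_size s e o t : label_step s e o t ->
  position e + ein e <= size s /\ size t = size s - ein e + eout e.
Proof.
case=> u [w] [w'] [v] [hu -> -> /label_event_size[hw hw']].
by rewrite !size_cat hu hw hw'; lia.
Qed.

(** A state has one label per strand, so a labelling certifies every size condition tested by
    [closed_from] along [D]. *)
Lemma labelling_closed s D o t D' : labelling s D o t ->
  closed_from (size s) (D ++ D') = closed_from (size t) D'.
Proof.
elim: D s o => [|e D IH] s o /= => [[->]//|].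
by case=> s1 [ o1] [ o2] [/label_step_size[-> <-] /IH<-].
Qed.

Lemma label_event_shift k e w o w' :
  label_event (shift_event k e) w o w' <-> label_event e w o w'.
Proof. by case: e. Qed.

Lemma position_shift k e : position (shift_event k e) = k + position e.
Proof. by case: e. Qed.

Lemma label_step_shift u s e o t : label_step s e o t ->
  label_step (u ++ s) (shift_event (size u) e) o (u ++ t).
Proof.
case=> u1 [w] [w'] [v] [hu -> -> h].
exists (u ++ u1), w, w', v; rewrite position_shift size_cat hu !catA.
by split=> //; apply/label_event_shift.
Qed.

Lemma label_step_unshift k s e o t : label_step s (shift_event k e) o t ->
  exists u s' t', [/\ size u = k, s = u ++ s', t = u ++ t'
    & label_step s' e o t'].
Proof.
case=> u [w] [w'] [v] []; rewrite position_shift => hu -> ->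
  /label_event_shift h.
exists (take k u), (drop k u ++ w ++ v), (drop k u ++ w' ++ v).
rewrite !(catA (take k u)) cat_take_drop size_take hu; split=> //.
  by case: ltnP => //; lia.
by exists (drop k u), w, w', v; rewrite size_drop hu; split=> //; lia.
Qed.

Lemma labelling_shift u s D o t : labelling s D o t ->
  labelling (u ++ s) (map (shift_event (size u)) D) o (u ++ t).
Proof.
elim: D s o => [|e D IH] s o /= => [[-> ->]//|].
case=> s1 [ o1] [ o2] [h /IH h2 ->]; exists (u ++ s1), o1, o2; split=> //.
exact: label_step_shift.
Qed.

Lemma labelling_unshift k s D o t : k <= size s ->
  labelling s (map (shift_event k) D) o t ->
  exists u s' t', [/\ size u = k, s = u ++ s', t = u ++ t'
    & labelling s' D o t'].
Proof.
elim: D s o => [|e D IH] s o ks /=.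
  case=> -> ->; exists (take k s), (drop k s), (drop k s).
  by rewrite cat_take_drop size_takel.
case=> s1 [ o1] [ o2] [/label_step_unshift[u [s'] [t'] [hu -> -> h]] h2 ->].
have /IH/(_ h2) : k <= size (u ++ t') by rewrite size_cat hu leq_addr.
case=> u2 [s2] [t2] [hu2 /eqP]; rewrite eqseq_cat ?hu ?hu2 //.
case/andP=> /eqP<- /eqP<- -> h3.
by exists u, s', t2; split=> //; exists t', o1, o2.
Qed.

Lemma labelling_frame v s D o t : labelling s D o t ->
  labelling (s ++ v) D o (t ++ v).
Proof.
elim: D s o => [|e D IH] s o /= => [[-> ->]//|].
case=> s1 [ o1] [ o2] [[u [w] [w'] [v1] [hu -> hs1 h]] /IH h2 ->].
exists (s1 ++ v), o1, o2; split=> //.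
by exists u, w, w', (v1 ++ v); rewrite hs1 !catA.
Qed.

(** Keeping both boundary states [s] and [t] allows the replacement to be made inside a longer
    word. *)
Definition sim l m := forall s o t, labelling s l o t ->
  exists2 o', labelling s m o' t & same_parity o o'.

(* The closedness assumptions ensure that there are enough strands for the
   events of both words. *)
Definition sim_closed l m := forall s o t D,
  closed_from (size s) (l ++ D) -> closed_from (size s) (m ++ D) ->
  labelling s l o t -> exists2 o', labelling s m o' t & same_parity o o'.

Lemma sim_closedW l m : sim l m -> sim_closed l m.
Proof. by move=> h s o t D _ _; exact: h. Qed.

Lemma labelling_size_shift k s e D o t :
  labelling s (map (shift_event k) (e :: D)) o t -> k <= size s.
Proof.
by case=> s1 [ o1] [ o2] [/label_step_size[h _] _ _]; move: h;
  rewrite position_shift; lia.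
Qed.

Lemma sim_shift k e l m : sim (e :: l) m ->
  sim (map (shift_event k) (e :: l)) (map (shift_event k) m).
Proof.
move=> h s o t hr; case/labelling_unshift: (hr);
  first exact: labelling_size_shift hr.
move=> u [s'] [t'] [<- -> -> /h[ o' h1 h2]]; exists o' => //.
exact: labelling_shift.
Qed.

(** Serves the moves that create events from nothing: closedness of the longer word supplies the [N]
    strands, to the right of the first [k], on which the new events act. *)
Lemma sim_nil k N m :
  (forall s, N <= size s -> exists2 o, labelling s m o s
    & same_parity [::] o) ->
  (forall M D, closed_from M (map (shift_event k) m ++ D) -> k + N <= M) ->
  sim_closed [::] (map (shift_event k) m).
Proof.
move=> h hN s o t D _ /hN ks [-> ->].
have [|o2 h1 h2] := h (drop k s); first by rewrite size_drop; lia.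
exists o2 => //; have := labelling_shift (take k s) h1.
by rewrite size_takel ?cat_take_drop //; lia.
Qed.

Lemma label_step_cup0 x s : label_step s (Cup 0) [::] (x :: x :: s).
Proof. by exists [::], [::], [:: x; x], s; split=> //; exists x. Qed.

Lemma label_step_cup1 x y s : label_step (y :: s) (Cup 1) [::]
  (y :: x :: x :: s).
Proof. exact: (label_step_shift [:: y] (label_step_cup0 x s)). Qed.

Lemma label_step_cap0 x s : label_step (x :: x :: s) (Cap 0) [::] s.
Proof. by exists [::], [:: x; x], [::], s; split=> //; exists x. Qed.

Lemma label_step_cap1 x y s : label_step (y :: x :: x :: s) (Cap 1) [::]
  (y :: s).
Proof. exact: (label_step_shift [:: y] (label_step_cap0 x s)). Qed.

Lemma label_step_cross0 b x y s :
  label_step (x :: y :: s) (Cross b 0)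
    [:: if b then (x, y) else (y, x)] (y :: x :: s).
Proof. by exists [::], [:: x; y], [:: y; x], s; split=> //; exists x, y. Qed.

Lemma label_step_cross1 b x y z s :
  label_step (z :: x :: y :: s) (Cross b 1)
    [:: if b then (x, y) else (y, x)] (z :: y :: x :: s).
Proof. exact: (label_step_shift [:: z] (label_step_cross0 b x y s)). Qed.

Lemma labelling_cons s e o1 s1 D o2 t :
  label_step s e o1 s1 -> labelling s1 D o2 t ->
    labelling s (e :: D) (o1 ++ o2) t.
Proof. by exists s1, o1, o2. Qed.

Lemma labelling_nil s : labelling s [::] [::] s.
Proof. by []. Qed.

End Labellings.

(** * Tactics for short words whose events have position 0 or 1 *)

Ltac inj_cons := repeat match goal with
  | H : _ :: _ = _ :: _ |- _ => injection H; clear H; intros; subst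
  | H : [::] = _ :: _ |- _ => discriminate H
  | H : _ :: _ = [::] |- _ => discriminate H
  end.

(** As positions are 0 or 1, the prefix [u] has at most one label, and the state is determined by
    finitely many cases. *)
Ltac inv_step H :=
  let u := fresh "u" in
  let hu := fresh "hu" in let hs := fresh "hs" in let hl := fresh "hl" in
  let ht := fresh "ht" in
  destruct H as (u & ? & ? & ? & [hu hs ht hl]);
  destruct u as [|? [|? ?]]; simpl in hu; try discriminate hu; clear hu;
  simpl in hl;
  first [ destruct hl as (? & ? & [? ? ?]) | destruct hl as (? & [? ? ?]) ];
  subst; simpl in * |-; inj_cons.

Ltac inv_labelling := repeat match goal with
  | H : labelling _ (_ :: _) _ _ |- _ => destruct H as (? & ? & ? & [? ? ?]);
    subst
  | H : labelling _ [::] _ _ |- _ => destruct H; subst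
  | H : label_step _ _ _ _ |- _ => inv_step H
  end.

Ltac build_labelling := eexists;
  [ repeat first [ exact: labelling_nil
    | apply: labelling_cons; first
        (first [ eapply label_step_cap0 | eapply label_step_cap1
         | eapply label_step_cross0 | eapply label_step_cross1
         | eapply label_step_cup0 | eapply label_step_cup1 ]) ] |].

Lemma diag_eqF (T : eqType) (x p q : T) : p != q -> ((x, x) == (p, q)) = false.
Proof. by move=> pq; rewrite xpair_eqE; case: eqP => //= ->; exact: negbTE. Qed.

Ltac solve_parity := let p := fresh "p" in let q := fresh "q" in
  let pq := fresh "pq" in move=> p q pq;
  repeat match goal with b : bool |- _ => destruct b end;
  rewrite /= ?addn0 ?(diag_eqF _ pq) //=;
  repeat case: (_ == _) => //=.

Ltac solve_sim := move=> ? ? ? ?; inv_labelling; build_labelling; solve_parity.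
Ltac solve_sim_nil i N :=
  apply: (@sim_nil _ i N) ;
  [ case=> [|? [|? ?]] // _; build_labelling; solve_parity
  | move=> ? ? /=; lia].

(** * Invariance under the Reidemeister and Morse moves *)

Section Moves.
Context (R : realType) (T : eqType).

Lemma level_far_sim e f : position e <= position f ->
  sim (T := T) [:: e; shift_event (eout e) f] [:: shift_event (ein e) f; e]
  /\ sim (T := T) [:: shift_event (ein e) f; e] [:: e; shift_event (eout e) f].
Proof.
move=> ef.
split=> s o t [s1] [ o1] [ o2] [h1 [t1] [ o3] [ o4] [h2 [-> ->] ->] ->].
- case: h1 => u [w] [w'] [v] [hu -> hs1 he].
  have [sw sw'] := label_event_size he.
  case: h2 => u2 [w2] [w2'] [v2] []; rewrite position_shift => hu2 hs2 ->.
  move=> /label_event_shift hf.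
  (* As [f] lies to the right of [e], the strands to its left include all those leaving [e], so [u2]
     begins with [u ++ w']. *)
  have hu2' : u2 = (u ++ w') ++ drop (size (u ++ w')) u2.
    rewrite -{1}(cat_take_drop (size (u ++ w')) u2); congr (_ ++ _).
    have := congr1 (take (size (u ++ w'))) hs2.
    rewrite {1}hs1 catA take_size_cat // takel_cat //.
    by rewrite size_cat; lia.
  move: (drop _ _) hu2' => u3 hu3; subst u2.
  move: hs2; rewrite hs1 -!catA => /eqP; rewrite eqseq_cat // eqxx /=.
  rewrite eqseq_cat // eqxx => /eqP ->.
  exists (o3 ++ o1 ++ [::]); last first.
    move=> p q _; rewrite !cats0 !count_cat addnC //.
  exists (u ++ w ++ u3 ++ w2' ++ v2), o3, (o1 ++ [::]); split=> //.
    exists (u ++ w ++ u3), w2, w2', v2; rewrite -!catA position_shift.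
    split=> //; last exact/label_event_shift.
    by move: hu2; rewrite !size_cat; lia.
  exists (u ++ w' ++ u3 ++ w2' ++ v2), o1, [::]; split=> //.
  by exists u, w, w', (u3 ++ w2' ++ v2).
- case: h2 => u [w] [w'] [v] [hu hs1 -> he].
  have [sw sw'] := label_event_size he.
  case: h1 => u2 [w2] [w2'] [v2] []; rewrite position_shift => hu2 -> hs2.
  move=> /label_event_shift hf.
  have hu2' : u2 = (u ++ w) ++ drop (size (u ++ w)) u2.
    rewrite -{1}(cat_take_drop (size (u ++ w)) u2); congr (_ ++ _).
    have := congr1 (take (size (u ++ w))) hs2.
    rewrite {1}hs1 catA take_size_cat // takel_cat //.
    by rewrite size_cat; lia.
  move: (drop _ _) hu2' => u3 hu3; subst u2.
  move: hs2; rewrite hs1 -!catA => /eqP; rewrite eqseq_cat // eqxx /=.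
  rewrite eqseq_cat // eqxx => /eqP ->.
  exists (o3 ++ o1 ++ [::]); last first.
    move=> p q _; rewrite !cats0 !count_cat addnC //.
  exists (u ++ w' ++ u3 ++ w2 ++ v2), o3, (o1 ++ [::]); split=> //.
    by exists u, w, w', (u3 ++ w2 ++ v2).
  exists (u ++ w' ++ u3 ++ w2' ++ v2), o1, [::]; split=> //.
  exists (u ++ w' ++ u3), w2, w2', v2; rewrite -!catA position_shift.
  split=> //; last exact/label_event_shift.
  by move: hu2; rewrite !size_cat; lia.
Qed.

(** Each move is checked at positions 0 and 1 and then shifted by [i]. Reidemeister 1 involves
    self-crossings only, Reidemeister 2 repeats one ordered pair twice, Reidemeister 3 permutes its
    three pairs, and the other moves keep all pairs. *)
Lemma RMmove_sim (l m : seq event) (w : R) : RMmove l m w ->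
  sim (T := T) l m /\ sim_closed (T := T) m l.
Proof.
case=> {l m w}.
- move=> b i.
  have -> : [:: Cup i.+1; Cross b i; Cap i.+1] =
    map (shift_event i) [:: Cup 1; Cross b 0; Cap 1] by rewrite /= addn0 addn1.
  split; first by apply: (@sim_shift T i _ _ [::]); solve_sim.
  by solve_sim_nil i 1.
- move=> b i.
  have -> : [:: Cup i; Cross b i.+1; Cap i] =
    map (shift_event i) [:: Cup 0; Cross b 1; Cap 0] by rewrite /= addn0 addn1.
  split; first by apply: (@sim_shift T i _ _ [::]); solve_sim.
  by solve_sim_nil i 1.
- move=> b i; rewrite -(addn0 i).
  split; last apply: sim_closedW.
    by apply: (@sim_shift T i (Cross b 0) [:: Cap 0] [:: Cap 0]); solve_sim.
  by apply: (@sim_shift T i (Cap 0) [::] [:: Cross b 0; Cap 0]); solve_sim.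
- move=> b i; rewrite -(addn0 i).
  split; last apply: sim_closedW.
    by apply: (@sim_shift T i (Cup 0) [:: Cross b 0] [:: Cup 0]); solve_sim.
  by apply: (@sim_shift T i (Cup 0) [::] [:: Cup 0; Cross b 0]); solve_sim.
- move=> b i; rewrite -(addn0 i).
  split; first by apply: (@sim_shift T i (Cross b 0) [:: Cross (~~ b) 0] [::]);
    solve_sim.
  change (sim_closed (T := T) [::]
    (map (shift_event i) [:: Cross b 0; Cross (~~ b) 0])).
  by solve_sim_nil i 2.
- move=> a b c i _; rewrite -(addn1 i) -{1 3 5 8 10 12}(addn0 i).
  split; last apply: sim_closedW.
    by apply: (@sim_shift T i (Cross a 0) [:: Cross b 1; Cross c 0]
      [:: Cross c 1; Cross b 0; Cross a 1]); solve_sim.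
  by apply: (@sim_shift T i (Cross c 1) [:: Cross b 0; Cross a 1]
      [:: Cross a 0; Cross b 1; Cross c 0]); solve_sim.
- move=> i.
  have -> : [:: Cup i; Cap i.+1] =
    map (shift_event i) [:: Cup 0; Cap 1] by rewrite /= addn0 addn1.
  split; first by apply: (@sim_shift T i _ _ [::]); solve_sim.
  by solve_sim_nil i 1.
- move=> i.
  have -> : [:: Cup i.+1; Cap i] =
    map (shift_event i) [:: Cup 1; Cap 0] by rewrite /= addn0 addn1.
  split; first by apply: (@sim_shift T i _ _ [::]); solve_sim.
  by solve_sim_nil i 1.
- by move=> e f /level_far_sim[h1 h2]; split=> //; exact: sim_closedW.
- move=> b i; rewrite -(addn1 i) -{2 3 5 8}(addn0 i).
  split; last apply: sim_closedW.
    by apply: (@sim_shift T i (Cross b 1) [:: Cap 0]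
      [:: Cross (~~ b) 0; Cap 1]); solve_sim.
  by apply: (@sim_shift T i (Cross (~~ b) 0) [:: Cap 1] [:: Cross b 1; Cap 0]);
    solve_sim.
- move=> b i; rewrite -(addn1 i) -{1 4 6 7}(addn0 i).
  split; last apply: sim_closedW.
    by apply: (@sim_shift T i (Cup 0) [:: Cross b 1]
      [:: Cup 1; Cross (~~ b) 0]); solve_sim.
  by apply: (@sim_shift T i (Cup 1) [:: Cross (~~ b) 0] [:: Cup 0; Cross b 1]);
    solve_sim.
Qed.
End Moves.

(** * Invariance under full twists *)

Section Twists.
Context (T : eqType).
Implicit Types (s t u v w a c : seq T) (o : seq (T * T)).

(** One row carries the leftmost strand across all the others to the right end, always over them if
    [b], always under them otherwise. *)
Lemma labelling_row b x w :
  labelling (x :: w) [seq Cross b j | j <- iota 0 (size w)]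
    [seq if b then (x, y) else (y, x) | y <- w] (rcons w x).
Proof.
elim: w => [|y w IH] //.
rewrite [size _]/= (iotaD 0 1) map_cat.
apply: (labelling_cons (label_step_cross0 b x y w)).
have := labelling_shift [:: y] IH; rewrite -map_comp (iotaDl 1 0) -map_comp.
exact.
Qed.

(** The strands of [a] cross all the others one after another, cycling to the right end. The split
    [a ++ c] is the form that passes through the induction; [c] empty gives one full twist. *)
Lemma labelling_rows b a c : exists2 o,
  labelling (a ++ c)
    (flatten (nseq (size a) [seq Cross b j | j <- iota 0 (size (a ++ c)).-1]))
    o (c ++ a)
  & forall p q, p != q -> count_mem (p, q) o =
      (if b then count_mem p a * count_mem q (a ++ c)
       else count_mem q a * count_mem p (a ++ c))%N.
Proof.
elim: a c => [|x a IH] c.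
  by rewrite /= cats0; exists [::] => // p q _; rewrite !mul0n; case: b.
have [ o h1 h2] := IH (rcons c x).
have hs : size (x :: a ++ c) = size (a ++ rcons c x).
  by rewrite /= !size_cat size_rcons addnS.
exists ([seq if b then (x, y) else (y, x) | y <- a ++ c] ++ o).
  apply/labelling_cat; exists (a ++ rcons c x).
  rewrite -rcons_cat; eexists _, _; split; [exact: labelling_row| |by []].
  by move: h1; rewrite -hs cat_rcons /= rcons_cat.
move=> p q pq; rewrite [LHS]count_cat h2 // count_map.
have cE r' : count_mem r' (a ++ rcons c x) = (x == r') + count_mem r' (a ++ c).
  by rewrite !count_cat -cats1 count_cat /=; lia.
rewrite !cE; set C := count _ (a ++ c).
have {C}-> : C = (if b then (x == p) * count_mem q (a ++ c)
                  else (x == q) * count_mem p (a ++ c))%N.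
  rewrite {}/C; case: (b).
  - rewrite (@eq_count _ _ (fun y => (x == p) && (y == q))); last first.
      by move=> y; rewrite /= xpair_eqE.
    by case: eqP => _; rewrite ?mul1n // mul0n count_pred0.
  - rewrite (@eq_count _ _ (fun y => (x == q) && (y == p))); last first.
      by move=> y; rewrite /= xpair_eqE andbC.
    by case: eqP => _; rewrite ?mul1n // mul0n count_pred0.
rewrite [(x :: a) ++ c]/= /=.
case: (b).
- by case: (x =P p) => [->|_]; rewrite ?(negbTE pq); lia.
- by case: (x =P q) => [->|_]; rewrite ?[q == p]eq_sym ?(negbTE pq); lia.
Qed.

Lemma labelling_full_twists0 b k w : exists2 o,
  labelling w (full_twists b k 0 (size w)) o w
  & forall p q, p != q ->
      count_mem (p, q) o = (k * (count_mem p w * count_mem q w))%N.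
Proof.
elim: k => [|k [ o h1 h2]]; first by exists [::].
have [ o1] := labelling_rows b w [::]; rewrite cats0 => h3 h4.
exists (o1 ++ o).
  rewrite /full_twists mulSn nseqD flatten_cat.
  by apply/labelling_cat; exists w, o1, o.
by move=> p q pq; rewrite count_cat h2 // h4 // mulSn; case: (b); lia.
Qed.

Lemma full_twists_shift b k i n :
  full_twists b k i n = map (shift_event i) (full_twists b k 0 n).
Proof.
rewrite /full_twists map_flatten map_nseq -map_comp.
by rewrite -{1}(addn0 i) iotaDl -map_comp.
Qed.

Lemma labelling_full_twists b k u w v : exists2 o,
  labelling (u ++ w ++ v) (full_twists b k (size u) (size w)) o (u ++ w ++ v)
  & forall p q, p != q ->
      count_mem (p, q) o = (k * (count_mem p w * count_mem q w))%N.
Proof.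
have [ o h1 h2] := labelling_full_twists0 b k w; exists o => //.
by rewrite full_twists_shift; apply/labelling_shift/labelling_frame.
Qed.

Lemma label_step_cross_inj b i s o t o' t' :
  label_step s (Cross b i) o t -> label_step s (Cross b i) o' t' ->
    o = o' /\ t = t'.
Proof.
case=> u [w] [w'] [v] [hu -> -> [x] [y] [-> -> ->]].
case=> u1 [w1] [w1'] [v1] [hu1 /eqP hs -> [x1] [y1] [hw -> ->]].
move: hs; rewrite hw eqseq_cat ?hu ?hu1 //= => /andP[/eqP-> /eqP[-> -> ->]].
by [].
Qed.

(** A crossing only transposes labels, so the state below determines everything above. This
    identifies an arbitrary labelling of a twist with the one computed explicitly when the twist is
    removed. *)
Lemma labelling_cross_inj D s o t o' t' : all is_crossing D ->
  labelling s D o t -> labelling s D o' t' -> o = o' /\ t = t'.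
Proof.
elim: D s o o' => [|e D IH] s o o' /=; first by move=> _ [-> ->] [-> ->].
case: e => // b i hD [s1] [ o1] [ o2] [h1 h2 ->] [s3] [ o3] [ o4] [h3 h4 ->].
by have [-> es] := label_step_cross_inj h1 h3; subst s3;
  have [-> ->] := IH _ _ _ hD h2 h4.
Qed.

Lemma closed_from_cross N D1 e D2 : all is_crossing D1 ->
  closed_from N (D1 ++ e :: D2) -> position e + ein e <= N.
Proof.
elim: D1 N => [|f D1 IH] N /=; first by move=> _ /andP[].
case: f => // b i hD /andP[/= hi /(IH _ hD)]; lia.
Qed.

Lemma all_crossing_full_twists b k i n : all is_crossing (full_twists b k i n).
Proof.
rewrite /full_twists; elim: (k * n)%N => //= m IH.
by rewrite all_cat IH andbT all_map; apply/allP.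
Qed.

Lemma full_twists_closed b k i n N D : 0 < k -> 1 < n ->
  closed_from N (full_twists b k i n ++ D) -> i + n <= N.
Proof.
move=> k0 n1; rewrite /full_twists.
(* The two rewrites isolate the first row and then its last crossing, at position [i + n - 2], which
   requires [i + n] strands. *)
have -> : (k * n = (k * n).-1.+1)%N by lia.
have -> : n.-1 = n.-2 + 1 by lia.
rewrite /= iotaD map_cat -!catA => /closed_from_cross /=.
by rewrite all_map => h; have := h (introT allP (fun _ _ => isT)); lia.
Qed.

Lemma full_twists_small b k i n : n <= 1 -> full_twists b k i n = [::].
Proof.
move=> n1; rewrite /full_twists; have -> : n.-1 = 0 by lia.
by elim: (k * n)%N.
Qed.

(** Any two strands pass over each other [k] times in each order, an even number, so distinct labels
    see no change of parity. *)
Lemma full_twists_sim b k i n : 0 < k -> ~~ odd k ->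
  sim_closed (T := T) [::] (full_twists b k i n) /\
  sim_closed (T := T) (full_twists b k i n) [::].
Proof.
move=> k0 ek; have [n1|n1] := leqP n 1.
  by rewrite full_twists_small //; split; apply: sim_closedW => s o t h;
    exists o.
have run s D : closed_from (size s) (full_twists b k i n ++ D) ->
    exists2 o, labelling s (full_twists b k i n) o s & same_parity [::] o.
  move/(full_twists_closed k0 n1) => hs.
  have [ o] := labelling_full_twists b k (take i s) (take n (drop i s))
    (drop n (drop i s)).
  rewrite !cat_take_drop size_takel ?size_takel ?size_drop; [|lia..].
  move=> h1 h2; exists o => // p q pq.
  by rewrite h2 // oddM (negbTE ek).
split=> s o t D h h'.
- by case=> -> ->; exact: run h'.
- have [ o1 h1 h2] := run _ _ h.
  move=> /(labelling_cross_inj (all_crossing_full_twists b k i n) h1)[<- <-].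
  by exists [::] => //; exact: same_parity_sym.
Qed.

End Twists.

(** * Invariants of diagrams along paths of moves *)

Definition sim_word (D D' : seq event) := forall (T : eqType) (o : seq (T * T)),
  labelling [::] D o [::] -> exists2 o', labelling [::] D' o' [::]
    & same_parity o o'.

Lemma sim_word_local (u l m v : seq event) :
  closed_from 0 (u ++ l ++ v) -> closed_from 0 (u ++ m ++ v) ->
  (forall T : eqType, sim_closed (T := T) l m) ->
  sim_word (u ++ l ++ v) (u ++ m ++ v).
Proof.
move=> hl hm h T o /labelling_cat[s] [ o1] [ o2] [h1] /labelling_cat[t] [ o3] [
  o4] [h3 h4 -> ->].
have [|| o5 h5 h6] := h T s o3 t v _ _ h3.
- by rewrite -(labelling_closed _ h1).
- by rewrite -(labelling_closed _ h1).
exists (o1 ++ o5 ++ o4); last by do ?apply: same_parity_cat.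
apply/labelling_cat; exists s, o1, (o5 ++ o4); split=> //.
by apply/labelling_cat; exists t, o5, o4.
Qed.

Lemma diagram_step_sim (R : realType) r (D D' : diagram) (w : R) : 0 < r ->
  diagram_step r D D' w -> sim_word D D' /\ sim_word D' D.
Proof.
move=> r0 h; have := word_closed D; have := word_closed D'.
case: h => {w} [u l m v w h|u v b i n] -> -> cD' cD.
- case: h => h; split; apply: sim_word_local => // T;
    have [h1 h2] := RMmove_sim T h; try exact: h2; exact: sim_closedW.
- have k0 : 0 < 4 * r by lia.
  have ek : ~~ odd (4 * r) by rewrite oddM.
  split; [apply: (@sim_word_local u [::] (full_twists b (4 * r) i n) v)
    | apply: (@sim_word_local u (full_twists b (4 * r) i n) [::] v)] => // T;
  by have [] := full_twists_sim T b i n k0 ek.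
Qed.

Definition pairwise_linked n (D : seq event) := exists2 o : seq ('I_n * 'I_n),
  labelling [::] D o [::] & forall a b, a != b -> odd (count_mem (a, b) o).

Definition unlinked_label (T : eqType) (o : seq (T * T)) (p : T) := forall q,
  q != p -> ~~ odd (count_mem (p, q) o) && ~~ odd (count_mem (q, p) o).

(* Weaker than having at most [n] components, but visible at the crossings alone
   and hence invariant under the moves. *)
Definition components_le n (D : seq event) := forall (T : finType) o,
  n < #|T| -> labelling [::] D o [::] -> exists p : T, unlinked_label o p.

Lemma weighted_path_linked (R : realType) r n (D D' : diagram) (W : R) :
  0 < r -> weighted_path r D D' W ->
  pairwise_linked n D /\ components_le n D ->
    pairwise_linked n D' /\ components_le n D'.
Proof.
move=> r0; elim=> {D D' W} [//|D D1 D2 w W /diagram_step_sim h _ IH [hl hf]].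
apply: IH; have [h1 h2] := h r0; split.
(* Existence of a labelling is carried forward from [D] to [D1]; the statement about all labellings
   pulls one of [D1] back to [D]. *)
- case: hl => o /h1[ o1 ho eqo] lo; exists o1 => // a b ab.
  by rewrite -eqo ?lo.
- move=> T o nT /h2[ o1 ho eqo]; have [p hp] := hf T o1 nT ho.
  by exists p => q qp; rewrite !eqo ?hp // eq_sym.
Qed.

Lemma labelling_map (T T' : eqType) (f : T -> T') s D o t : labelling s D o t ->
  labelling (map f s) D [seq (f x.1, f x.2) | x <- o] (map f t).
Proof.
elim: D s o => [|e D IH] s o /= => [[-> ->]//|].
case=> s1 [ o1] [ o2] [[u [w [w' [v [hu -> hs1 h]]]]] /IH h2 ->].
exists (map f s1), [seq (f x.1, f x.2) | x <- o1],
  [seq (f x.1, f x.2) | x <- o2].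
split=> //; last by rewrite map_cat.
exists (map f u), (map f w), (map f w'), (map f v).
rewrite size_map hs1 !map_cat; split=> //.
case: e h {hu} => [i|i|b i] /=.
- by case=> x [-> -> ->]; exists (f x).
- by case=> x [-> -> ->]; exists (f x).
- by case=> x [y] [-> -> ->]; exists (f x), (f y); case: b.
Qed.

Lemma absent_label (T : finType) (s : seq T) : size s < #|T| ->
  exists x, x \notin s.
Proof.
move=> h; apply/existsP; apply: contraLR h; rewrite negb_exists -leqNgt.
move=> /forallP h; apply: leq_trans (card_size s); apply/subset_leq_card.
by apply/fintype.subsetP => x _; have := h x; rewrite negbK.
Qed.

Lemma count_relabel (T T' : eqType) (f : T -> T') (o : seq (T * T)) p q b c :
  (forall x, (f x == p) = (x == b)) -> (forall x, (f x == q) = (x == c)) ->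
  count_mem (p, q) [seq (f x.1, f x.2) | x <- o] = count_mem (b, c) o.
Proof.
move=> hp hq; rewrite count_map; apply: eq_count => -[x y] /=.
by rewrite !xpair_eqE hp hq.
Qed.

Lemma count_relabel0 (T T' : eqType) (f : T -> T') (o : seq (T * T)) p q :
  (forall x, f x != p) ->
  count_mem (p, q) [seq (f x.1, f x.2) | x <- o] = 0 /\
  count_mem (q, p) [seq (f x.1, f x.2) | x <- o] = 0.
Proof.
move=> hp; rewrite !count_map; split; apply/eqP;
  rewrite -leqn0 leqNgt -has_count;
  apply/hasPn => -[x y] _ /=; by rewrite xpair_eqE (negbTE (hp _)) ?andbF.
Qed.

(** Of the label sets just below and just above an event, one contains the other, so a label missing
    from the larger is missing on both sides and at the event itself. *)
Lemma label_step_sub (T : eqType) (s t : seq T) e o : label_step s e o t ->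
  {subset s <= t} /\ o = [::] \/
  {subset t <= s} /\ forall x, x \in o -> x.1 \in s /\ x.2 \in s.
Proof.
case=> u [w] [w'] [v] [_ -> -> h]; case: e h => [i|i|b i] /=.
- case=> x [-> -> ->]; left; split=> // y.
  by rewrite !mem_cat !inE; case: (y \in u) (y \in v) => [|] [|]; rewrite ?orbT.
- case=> x [-> -> ->]; right; split=> // y.
  by rewrite !mem_cat !inE; case: (y \in u) (y \in v) => [|] [|]; rewrite ?orbT.
- case=> x [y] [-> -> ->]; right; split=> [z|[z z']].
    by rewrite !mem_cat !inE; case: (z \in u) (z \in v) (z == x) (z == y) =>
      [|] [|] [|] [|].
  rewrite inE !mem_cat !inE /=; case: b => /eqP[-> ->];
  by rewrite !eqxx !orbT.
Qed.

(** * Pairwise linking bounds the girth from below *)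

Section Girth.
Context (n : nat).
Hypothesis n_gt2 : 2 < n.
Implicit Types (a b c : 'I_n) (o : seq ('I_n * 'I_n)) (s : seq 'I_n).

(* Otherwise splitting the label [a] in two at the cut would give a labelling by
   [n.+1] labels each of which is linked with another one. *)
Lemma cut_dichotomy D1 D2 o1 o2 s a : components_le n (D1 ++ D2) ->
  labelling [::] D1 o1 s -> labelling s D2 o2 [::] ->
  (forall b c, b != c -> odd (count_mem (b, c) (o1 ++ o2))) -> a \notin s ->
  exists z, forall b, b != a ->
    odd (count_mem (a, b) o1) = z /\ odd (count_mem (b, a) o1) = z.
Proof.
move=> few h1 h2 hodd has.
(* Above the cut [a] becomes [None], below it becomes [Some a]; the two relabellings agree at the
   cut because [a] is absent there. *)
pose f x := if x == a then None else Some x.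
have fa x : (f x == None) = (x == a) by rewrite /f; case: (x =P a).
have fb c : c != a -> forall x, (f x == Some c) = (x == c).
  by move=> ca x; rewrite /f; case: (x =P a) => // ->;
    rewrite [RHS]eq_sym (negbTE ca).
have f0 x : f x != Some a by rewrite /f; case: (x =P a) => // /eqP;
  apply: contra => /eqP[->].
have g c (x : 'I_n) : (Some x == Some c) = (x == c) by [].
have g0 (x : 'I_n) : Some x != None by [].
have hs : map f s = map Some s.
  by apply/eq_in_map => x xs; rewrite /f; case: (x =P a) => // xa;
    rewrite -xa xs in has.
have /few : n < #|{: option 'I_n}| by rewrite card_option card_ord.
have h : labelling [::] (D1 ++ D2) ([seq (Some x.1, Some x.2) | x <- o1]
    ++ [seq (f x.1, f x.2) | x <- o2]) [::].
  apply/labelling_cat; exists (map f s); rewrite {1}hs.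
  by do 2 eexists; split;
    [exact: (labelling_map Some h1)|exact: (labelling_map f h2)|].
move=> /(_ _ h){h} [[b|] hp].
(* If the unlinked label is [Some a], the lower part of [a] carries even parities and [z] is
   false. *)
- have [ba|ba] := eqVneq b a.
    exists false => c ca; move: (hp (Some c)); rewrite ba g => /(_ ca).
    rewrite !count_cat (count_relabel _ (g a) (g c))
      (count_relabel _ (g c) (g a)).
    by have [-> ->] := count_relabel0 o2 (Some c) f0;
      rewrite !addn0 => /andP[/negbTE-> /negbTE->].
  (* A label [b] other than [a] cannot be unlinked: a third label [c], available since [2 < n], is
     still linked with it. *)
  have [c] : exists c, c \notin [:: a; b].
    by apply: absent_label; rewrite card_ord.
  rewrite !inE negb_or => /andP[ca cb].
  move: (hp (Some c)); rewrite g => /(_ cb) /andP[].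
  rewrite count_cat (count_relabel _ (g b) (g c)).
  rewrite (count_relabel _ (fb _ ba) (fb _ ca)) -count_cat.
  by rewrite hodd // eq_sym.
(* If [None] is unlinked, the upper part of [a] carries even parities, so all the odd ones come from
   below. *)
- exists true => c ca; move: (hp (Some c)) => /(_ isT).
  rewrite !count_cat (count_relabel _ fa (fb _ ca))
    (count_relabel _ (fb _ ca) fa).
  have [-> ->] := count_relabel0 o1 (Some c) g0; rewrite !add0n.
  move=> /andP[/negbTE e1 /negbTE e2].
  have := hodd c a ca; rewrite count_cat oddD e2 addbF => ->.
  by have := hodd a c; rewrite eq_sym count_cat oddD e1 addbF => /(_ ca) ->.
Qed.

(* If all levels were thin, the labels absent from the current level would be
   unlinked below it, from the bottom of the diagram up to its top. *)
Lemma thick_level D2 D1 o1 o2 s : components_le n (D1 ++ D2) ->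
  labelling [::] D1 o1 s -> labelling s D2 o2 [::] ->
  (forall b c, b != c -> odd (count_mem (b, c) (o1 ++ o2))) ->
  (forall k, k \in line_counts (size s) D2 -> k < n) ->
  (forall a b, a \notin s -> b != a -> ~~ odd (count_mem (a, b) o1)) -> False.
Proof.
elim: D2 D1 o1 o2 s => [|e D2 IH] D1 o1 o2 s few h1.
  case=> hs ->; rewrite -hs cats0 => hodd _ /(_ (Ordinal (ltnW (ltnW n_gt2)))
    (Ordinal n_gt2)).
  by rewrite hodd // => /(_ isT isT).
case=> t [ oe] [ o3] [he h3 eo] hodd hk hev.
have [ht hst] := label_step_size he.
have st : size s < n by apply: hk; rewrite inE eqxx.
have hk' k : k \in line_counts (size t) D2 -> k < n.
  by move=> kt; apply: hk; rewrite /= !inE -hst kt !orbT.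
have tn : size t < n by apply: hk'; case: (D2) => [|? ?]; rewrite inE eqxx.
have h1' : labelling [::] (D1 ++ [:: e]) (o1 ++ oe) t.
  apply/labelling_cat; exists s, o1, oe; split=> //.
  by exists t, oe, [::]; rewrite cats0.
have hodd' b c : b != c -> odd (count_mem (b, c) ((o1 ++ oe) ++ o3)).
  by rewrite -catA -eo; exact: hodd.
have few' : components_le n ((D1 ++ [:: e]) ++ D2) by rewrite -catA.
(* Both levels next to [e] are thin, so some label avoids them and the event. *)
have [a [as_ at_ ae]] : exists a, [/\ a \notin s, a \notin t
    & forall b, count_mem (a, b) oe = 0].
  case: (label_step_sub he) => [[sub ->]|[sub hoe]].
    have [a ha] : exists a, a \notin t by apply: absent_label; rewrite card_ord.
    by exists a; split=> //; apply: contra ha; exact: sub.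
  have [a ha] : exists a, a \notin s by apply: absent_label; rewrite card_ord.
  exists a; split=> [//||b]; first by apply: contra ha; exact: sub.
  apply/eqP; rewrite -leqn0 leqNgt -has_count;
    apply/hasPn => -[x y] /hoe /=[xs _].
  by rewrite xpair_eqE; case: eqP => // xa; rewrite -xa xs in ha.
apply: (IH _ _ _ _ few' h1' h3 hodd' hk') => c b ct bc.
have [z hz] := cut_dichotomy few' h1' h3 hodd' at_.
have [y hy] := cut_dichotomy few' h1' h3 hodd' ct.
(* For this [a] nothing changes at [e], and it is unlinked below [s] by hypothesis. *)
have z0 : z = false.
  have [d] : exists d, d \notin [:: a] by apply: absent_label;
    rewrite card_ord ltnW.
  rewrite inE => da; have [<- _] := hz d da.
  by rewrite count_cat ae addn0; apply/negbTE/hev.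
have [-> _] := hy b bc.
have [ca|ca] := eqVneq c a.
  by have [hb _] := hy b bc; have := hz b; rewrite -ca hb => /(_ bc)[->];
    rewrite z0.
(* The parity of the pair [(c, a)] is both [y] and [z], so every label absent from [t] inherits the
   value false from [a]. *)
have [_ hc] := hz c ca; have := hy a; rewrite eq_sym => /(_ ca)[ha _].
by rewrite -ha hc z0.
Qed.

Lemma girth_linked (D : diagram) : pairwise_linked n D -> components_le n D ->
  n <= girth D.
Proof.
case=> o hrun hodd few; rewrite leqNgt; apply/negP => hg.
apply: (@thick_level D [::] [::] o [::]) => // k hk.
apply: leq_ltn_trans hg; exact: (@leq_bigmax_seq _ _ xpredT id).
Qed.

End Girth.

(** * The closed full twist on n strands *)

Section TorusLink.

Definition is_cup (e : event) := if e is Cup _ then true else false.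

(** New labels enter only at minima, one for each; [c] lists them. *)
Lemma labelling_labels (T : eqType) D (s t : seq T) o : labelling s D o t ->
  exists c, size c = count is_cup D /\
    forall x, x \in o -> x.1 \in s ++ c /\ x.2 \in s ++ c.
Proof.
elim: D s o => [|e D IH] s o /=; first by case=> _ ->; exists [::].
case=> s1 [ o1] [ o2] [he /IH[c [sc hc]] ->].
have [d [sd hd ho]] : exists d, [/\ size d = is_cup e, {subset s1 <= s ++ d}
  & forall x, x \in o1 -> x.1 \in s /\ x.2 \in s].
  case: he => u [w] [w'] [v] [_ -> -> h]; case: e h => [i|i|b i] /=.
  - case=> x [-> -> ->]; exists [:: x]; split=> // y.
    by rewrite !mem_cat !inE; case: (y \in u) (y \in v) (y == x) => [|] [|] [|].
  - case=> x [-> -> ->]; exists [::]; split=> // y.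
    by rewrite !mem_cat !inE; case: (y \in u) (y \in v) (y == x) => [|] [|] [|].
  - case=> x [y] [-> -> ->]; exists [::]; split=> // [z|[z z']].
      by rewrite !mem_cat !inE; case: (z \in u) (z \in v) (z == x) (z == y) =>
        [|] [|] [|] [|].
    rewrite inE !mem_cat !inE /=; case: b => /eqP[-> ->];
    by rewrite !eqxx !orbT.
exists (d ++ c); rewrite size_cat sd sc; split=> // x.
rewrite catA [x \in _]mem_cat => /orP[/ho[h1 h2]|/hc[]].
  by rewrite !mem_cat h1 h2.
by rewrite 2!mem_cat => h1 h2; split; rewrite mem_cat;
 [case/orP: h1 => [/hd->|->] | case/orP: h2 => [/hd->|->]]; rewrite ?orbT.
Qed.

Lemma components_le_cups D : components_le (count is_cup D) D.
Proof.
move=> T o hT /labelling_labels[c [sc hc]]; rewrite -sc in hT.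
have [p hp] := absent_label hT; exists p => q _.
suff h x : p == x.1 \/ p == x.2 -> count_mem x o = 0.
  by rewrite !h //; [right|left]; rewrite /=.
move=> hx; apply/eqP; rewrite -leqn0 leqNgt -has_count;
  apply/hasPn => y /hc[h1 h2].
apply: contra hp => /= /eqP yx; subst y.
by case: hx => /eqP->.
Qed.

(** The (n, n) torus link: the twist acts on the left legs of n nested cups, and the right legs
    close the braid. *)
Definition torus_word n : seq event :=
  [seq Cup j | j <- iota 0 n] ++ full_twists true 1 0 n ++
  [seq Cap j | j <- rev (iota 0 n)].

(** The induction adds cups from the outside in; [u] lists the labels of those already placed. *)
Lemma labelling_cups (T : eqType) (u a : seq T) :
  labelling (u ++ rev u) [seq Cup j | j <- iota (size u) (size a)] [::]
    ((u ++ a) ++ rev (u ++ a)).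
Proof.
elim: a u => [|x a IH] u; first by rewrite cats0.
have := IH (rcons u x); rewrite size_rcons [rcons u x ++ a]cat_rcons => h.
apply: (@labelling_cons _ _ _ [::] _ _ [::] _ _ h);
exists u, [::], [:: x; x], (rev u).
by rewrite rev_rcons cat_rcons; split=> //; exists x.
Qed.

Lemma labelling_caps (T : eqType) (a : seq T) :
  labelling (a ++ rev a) [seq Cap j | j <- rev (iota 0 (size a))] [::] [::].
Proof.
elim/last_ind: a => [//|a x IH].
rewrite size_rcons -addn1 iotaD rev_cat map_cat.
apply: (@labelling_cons _ _ _ [::] _ _ [::] _ _ IH);
exists a, [:: x; x], [::], (rev a).
by rewrite rev_rcons cat_rcons; split=> //; exists x.
Qed.

Lemma labelling_torus (T : eqType) (w : seq T) : exists2 o,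
  labelling [::] (torus_word (size w)) o [::]
  & forall p q, p != q ->
      count_mem (p, q) o = (count_mem p w * count_mem q w)%N.
Proof.
have [ o h1 h2] := labelling_full_twists true 1 [::] w (rev w).
exists o => [|p q pq]; last by rewrite h2 // mul1n.
apply/labelling_cat; exists (w ++ rev w), [::], o; split=> //;
  first exact: (labelling_cups [::]).
by apply/labelling_cat; exists (w ++ rev w), o, [::]; rewrite cats0;
  split=> //; exact: labelling_caps.
Qed.

(** A labelling from no strands to no strands certifies closedness; here all labels equal [tt]. *)
Lemma torus_closed n : closed_from 0 (torus_word n).
Proof.
have [ o + _] := labelling_torus (nseq n tt).
by rewrite size_nseq => /(labelling_closed [::]) /=; rewrite cats0 => ->.
Qed.

Lemma torus_nonempty n : 0 < size (torus_word n.+1).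
Proof. by []. Qed.

(** The index is shifted to keep the word nonempty: this link has [n.+1] components. *)
Definition torus_link n := Diagram (torus_nonempty n) (torus_closed n.+1).

Lemma linked_torus n : pairwise_linked n (torus_word n).
Proof.
have [ o] := labelling_torus (enum 'I_n); rewrite size_enum_ord => h1 h2.
by exists o => // a b ab; rewrite h2 // !count_uniq_mem ?enum_uniq ?mem_enum.
Qed.

Lemma count_torus n :
  [/\ count is_cup (torus_word n) = n,
      count is_crossing (torus_word n) = (n * n.-1)%N
    & count is_extremum (torus_word n) = (n + n)%N].
Proof.
have hf : count is_crossing (full_twists true 1 0 n) = (n * n.-1)%N.
  rewrite -(size_iota 0 n.-1) /full_twists mul1n; elim: {1 3}n => //= m IH.
  by rewrite count_cat IH count_map count_predT size_iota.
have h0 P : (forall j, P (Cross true j) = false) ->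
  count P (full_twists true 1 0 n) = 0.
  move=> hP; rewrite /full_twists; elim: (1 * n)%N => //= m IH.
  by rewrite count_cat IH count_map (eq_count (a2 := pred0)) ?count_pred0.
have cT (P : pred nat) s : (forall j, P j) -> count P s = size s.
  by move=> hP; apply/eqP; rewrite -all_count; apply/allP => j _; exact: hP.
have cF (P : pred nat) s : (forall j, P j = false) -> count P s = 0.
  by move=> hP; rewrite (eq_count (a2 := pred0)) ?count_pred0.
rewrite /torus_word; split; rewrite !count_cat ?hf ?h0 // !count_map.
- by rewrite cT // cF // size_iota !addn0.
- by rewrite !cF // addn0.
- by rewrite !cT // size_rev size_iota.
Qed.

End TorusLink.

(** * Complexity estimate and choice of the number of strands *)

Import Order.TTheory GRing.Theory Num.Theory.
Local Open Scope ring_scope.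

Lemma torus_complexity_le (R : realType) n :
  0 < complexity R (torus_link n) <= (n.+1 ^ 2)%:R.
Proof.
have [_ h1 h2] := count_torus n.+1.
rewrite /complexity [word _]/= h1 h2 -mulrDl -natrD.
apply/andP; split; first by rewrite divr_gt0 ?ltr0n //; lia.
by rewrite ler_pdivrMr ?ltr0n // -natrM ler_nat; lia.
Qed.

Theorem theoremA (R : realType) (r : nat) (p : {poly R}) (b b' : R) :
  (5 <= r)%N -> r <> 6%N -> 0 < b -> 0 < b' ->
  exists D : diagram, forall D' : diagram, diagram_sim R r D D' ->
    (girth D')%:R > b * ln (complexity R D) + b' \/
    (dist R r D D' > (p.[complexity R D])%:E)%E.
Proof.
move=> r5 _ b0 b'0.
have x0 : 0 <= 4 * b + b' by lra.
(* With [m ^ 2] strands the complexity is at most [m ^ 4], whose logarithm is at most [4 * m]. As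
   [m] exceeds both 1 and [4 * b + b'], it follows that [b * (4 * m) + b' < m ^ 2]. *)
pose m := (Num.bound (4 * b + b')).+2.
have hm : 4 * b + b' + 1 < m%:R.
  have := archi_boundP x0; rewrite /m -addn2 natrD; lra.
have m2 : (1 < m)%N by [].
exists (torus_link (m ^ 2).-1) => D' _.
have eN : ((m ^ 2).-1.+1 = m ^ 2)%N by rewrite prednK // expn_gt0.
have [[W hW]|nopath] := pselect (exists W : R,
  weighted_path r (torus_link (m ^ 2).-1) D' W).
- left; have [c0 cle] := andP (torus_complexity_le R (m ^ 2).-1).
  have n3 : (2 < (m ^ 2).-1.+1)%N by rewrite eN -mulnn; nia.
  have [||hl hf] := weighted_path_linked (n := (m ^ 2).-1.+1) _ hW; first lia.
    split; first exact: linked_torus.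
    have [e _ _] := count_torus (m ^ 2).-1.+1.
    by rewrite -{1}e; exact: components_le_cups.
  have hg := girth_linked n3 hl hf.
  have hln : ln (complexity R (torus_link (m ^ 2).-1)) <= 4 * m%:R.
    rewrite eN -expnM natrX in cle.
    have m0 : 0 < (m%:R : R) by rewrite ltr0n.
    apply: (@le_trans _ _ (ln ((m%:R : R) ^+ 4))).
      by rewrite ler_ln ?posrE ?exprn_gt0.
    rewrite lnXn // -[_ *+ 4]mulr_natl; rewrite ler_pM2l ?ltr0n //.
    exact/ltW/ln_sublinear.
  apply: (@lt_le_trans _ _ ((m ^ 2)%:R)); last by rewrite ler_nat -eN.
  rewrite natrX expr2; have : 1 < (m%:R : R) by rewrite ltr1n.
  nra.
(* Without a path the infimum is over the empty set, hence [+oo], above any real value of [p]. *)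
- right; rewrite /dist (_ : [set _ | _ in _] = set0)%classic ?ereal_inf0 ?ltry
    //.
  by apply/seteqP; split=> // x [W hW _]; apply: nopath; exists W.
Qed.
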